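(* Let $p$ be a prime and let $G$ be a torsion-free abelian group. Then there is a group isomorphism $\eta : \mathcal{K}_p(G)\to G^{*p*p}$ from the pro-$p$ completion of $G$ to the $p$-adic double dual of $G$ such that $\eta(\Psi^p(g)) = \hat{g}^p$ for all $g\in G$ and $\eta$ is a homeomorphism.
   Context: $\mathbb{Z}_p$ denotes the $p$-adic integers. For a torsion-free abelian group $G$, $G^{*p}=\mathrm{Hom}(G,\mathbb{Z}_p)$ is the (torsion-free abelian) group of all group homomorphisms $G\to\mathbb{Z}_p$, and $G^{*p*p}=\mathrm{Hom}(G^{*p},\mathbb{Z}_p)$. For $g\in G$, $\hat{g}^p\in G^{*p*p}$ is $\hat{g}^p(f)=f(g)$. $G^{*p*p}$ carries the relative topology: the subspace topology inherited from the product space $\mathbb{Z}_p^{G^{*p}}$. The pro-$p$ completion $\mathcal{K}_p(G)$ is the inverse limit of the finite $p$-groups $G/N$, where $N$ ranges over all subgroups of $G$ such that $G/N$ is a finite $p$-group, with the natural quotient maps $G/N\to G/N'$ for $N\subseteq N'$; it is realized as a subgroup of $\prod_N G/N$ and has the subspace topology of the product topology, each $G/N$ being discrete. The natural homomorphism $\Psi^p : G\to\mathcal{K}_p(G)$ is $\Psi^p(g)=(g+N)_N$. *)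

(* Defs.v *)
From HB Require Import structures.
From mathcomp Require Import all_boot all_order all_algebra.
From mathcomp Require Import generic_quotient ring_quotient.
From mathcomp Require Import all_classical topology.

Set Implicit Arguments.
Unset Strict Implicit.
Unset Printing Implicit Defensive.

Import GRing.Theory.
Local Open Scope classical_set_scope.
Local Open Scope ring_scope.

Definition torsion_free (G : zmodType) : Prop :=
  forall (g : G) (n : nat), (0 < n)%N -> g *+ n = 0 -> g = 0.

Definition homeomorphism (X Y : topologicalType) (f : X -> Y) : Prop :=
  continuous f /\
  exists g : Y -> X, [/\ cancel f g, cancel g f & continuous g].

Section ProductGroup.
Variables (I : Type) (X : I -> zmodType).

Definition prodgroup : Type := forall i, X i.

HB.instance Definition _ := gen_eqMixin prodgroup.
HB.instance Definition _ := gen_choiceMixin prodgroup.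

Definition prodgroup_zero : prodgroup := fun=> 0.
Definition prodgroup_opp (x : prodgroup) : prodgroup := fun i => - x i.
Definition prodgroup_add (x y : prodgroup) : prodgroup := fun i => x i + y i.

Lemma prodgroup_addA : associative prodgroup_add.
Proof. by move=> x y z; apply: functional_extensionality_dep => i; exact: addrA. Qed.
Lemma prodgroup_addC : commutative prodgroup_add.
Proof. by move=> x y; apply: functional_extensionality_dep => i; exact: addrC. Qed.
Lemma prodgroup_add0 : left_id prodgroup_zero prodgroup_add.
Proof. by move=> x; apply: functional_extensionality_dep => i; exact: add0r. Qed.
Lemma prodgroup_addN : left_inverse prodgroup_zero prodgroup_opp prodgroup_add.
Proof. by move=> x; apply: functional_extensionality_dep => i; exact: addNr. Qed.

HB.instance Definition _ := GRing.isZmodule.Build prodgroup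
  prodgroup_addA prodgroup_addC prodgroup_add0 prodgroup_addN.

End ProductGroup.

(* The limit of an inverse system of discrete abelian groups: [r i j] means
   that there is a transition map from [X i] to [X j]. *)
Section InverseLimit.
Variables (I : Type) (r : I -> I -> Prop) (X : I -> zmodType).
Variable f : forall i j, r i j -> {additive X i -> X j}.

Definition coherent (x : prodgroup X) : bool :=
  `[< forall i j (h : r i j), f h (x i) = x j >].

Lemma coherent_zmod_closed : zmod_closed coherent.
Proof.
split=> [|x y /asboolP cx /asboolP cy]; apply/asboolP => i j h.
  exact: raddf0.
have -> : (x - y) i = x i - y i by [].
by rewrite raddfB cx cy.
Qed.
HB.instance Definition _ :=
  GRing.isZmodClosed.Build (prodgroup X) coherent coherent_zmod_closed.

Record invlim : Type :=
  InvLim { invlim_val :> prodgroup X; _ : coherent invlim_val }.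

HB.instance Definition _ := [isSub for invlim_val].
HB.instance Definition _ := [Choice of invlim by <:].
HB.instance Definition _ := [SubChoice_isSubZmodule of invlim by <:].

Definition invlim_incl (x : invlim) :
  prod_topology (fun i => discrete_topology (X i)) := invlim_val x.

HB.instance Definition _ :=
  Topological.copy invlim (initial_topology invlim_incl).

End InverseLimit.

(* The p-adic integers, as the limit of the groups Z/p^(n+1), n : nat; the
   exponents start from 1 because 'Z_1 is not the trivial group. As 'Z_m is
   Z/mZ only for m > 1, [padic p] is meaningful only for p > 1. *)
Section PadicIntegers.
Variable p : nat.

Definition padic_red (n m : nat) (h : (m <= n)%N) (x : 'Z_(p ^ n.+1)) :
  'Z_(p ^ m.+1) := inZp x.

Lemma padic_red_zmod_morphism n m (h : (m <= n)%N) :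
  zmod_morphism (padic_red h).
Proof.
have dv : ((Zp_trunc (p ^ m.+1)).+2 %| (Zp_trunc (p ^ n.+1)).+2)%N.
  have [p_le1|p_gt1] := leqP p 1.
    by case: p p_le1 => [|[]] // _; rewrite ?exp1n ?exp0n.
  by rewrite !Zp_cast ?dvdn_exp2l // -(expn0 p) ltn_exp2l.
move=> x y; apply: (addIr (padic_red h y)); rewrite subrK.
have redD (u v : 'Z_(p ^ n.+1)) :
    padic_red h (u + v) = padic_red h u + padic_red h v.
  by apply: val_inj; rewrite /= (modn_dvdm _ dv) modnDm.
by rewrite -redD subrK.
Qed.
HB.instance Definition _ n m (h : (m <= n)%N) :=
  GRing.isZmodMorphism.Build _ _ (padic_red h) (padic_red_zmod_morphism h).

Definition padic : Type :=
  invlim (fun n m (h : (m <= n)%N) =>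
            padic_red h : {additive 'Z_(p ^ n.+1) -> 'Z_(p ^ m.+1)}).

HB.instance Definition _ := GRing.Zmodule.on padic.
HB.instance Definition _ := Topological.on padic.

End PadicIntegers.

Section HomGroup.
Variables U V : zmodType.

HB.instance Definition _ := gen_eqMixin {additive U -> V}.
HB.instance Definition _ := gen_choiceMixin {additive U -> V}.

Lemma additive_ext (f g : {additive U -> V}) : f =1 g -> f = g.
Proof.
case: f g => [f [[a]]] [g [[b]]] /= /funext fg; subst g.
by rewrite (Prop_irrelevance a b).
Qed.

Definition hom_zero : {additive U -> V} := (\0 : U -> V).
Definition hom_opp (f : {additive U -> V}) : {additive U -> V} := (\- f).
Definition hom_add (f g : {additive U -> V}) : {additive U -> V} := (f \+ g).

Lemma hom_addA : associative hom_add.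
Proof. by move=> f g h; apply: additive_ext => x; exact: addrA. Qed.
Lemma hom_addC : commutative hom_add.
Proof. by move=> f g; apply: additive_ext => x; exact: addrC. Qed.
Lemma hom_add0 : left_id hom_zero hom_add.
Proof. by move=> f; apply: additive_ext => x; exact: add0r. Qed.
Lemma hom_addN : left_inverse hom_zero hom_opp hom_add.
Proof. by move=> f; apply: additive_ext => x; exact: addNr. Qed.

HB.instance Definition _ := GRing.isZmodule.Build {additive U -> V}
  hom_addA hom_addC hom_add0 hom_addN.

End HomGroup.

Section PadicDuals.
Variables (p : nat) (G : zmodType).

Definition pdual : zmodType := {additive G -> padic p}.

Definition pddual : Type := {additive pdual -> padic p}.

HB.instance Definition _ := GRing.Zmodule.on pddual.

Definition pddual_incl (phi : pddual) : {ptws pdual -> padic p} :=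
  fun f => (phi : {additive pdual -> padic p}) f.

HB.instance Definition _ :=
  Topological.copy pddual (initial_topology pddual_incl).

Definition evalp (g : G) (f : pdual) : padic p :=
  (f : {additive G -> padic p}) g.

Lemma evalp_zmod_morphism (g : G) : zmod_morphism (evalp g).
Proof. by []. Qed.
HB.instance Definition _ (g : G) :=
  GRing.isZmodMorphism.Build pdual (padic p) (evalp g) (evalp_zmod_morphism g).

Definition hatp (g : G) : pddual := (evalp g : {additive pdual -> padic p}).

End PadicDuals.

Definition finite_pgroup (p : nat) (Q : zmodType) : Prop :=
  exists k : nat, ([set: Q] #= `I_(p ^ k))%card.

Section QuotientMap.
Variables (G : zmodType) (N N' : zmodClosed G).

(* The natural map G/N -> G/N', characterized by [quot_map_pi]; the inclusion
   is not used to compute it, but makes it well defined and additive. *)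
Definition quot_map (sNN' : {subset N <= N'}) (x : Quotient.quot N) :
  Quotient.quot N' := (\pi_(Quotient.quot N') (repr x))%qT.

Lemma quot_map_pi (sNN' : {subset N <= N'}) (g : G) :
  quot_map sNN' (\pi_(Quotient.quot N) g)%qT = (\pi_(Quotient.quot N') g)%qT.
Proof.
apply/eqP; rewrite -Quotient.idealrBE; apply: sNN'.
by rewrite Quotient.idealrBE reprK.
Qed.

Lemma quot_map_zmod_morphism (sNN' : {subset N <= N'}) :
  zmod_morphism (quot_map sNN').
Proof.
move=> x y; rewrite -[x]reprK -[y]reprK -raddfB !quot_map_pi.
exact: raddfB.
Qed.
HB.instance Definition _ (sNN' : {subset N <= N'}) :=
  GRing.isZmodMorphism.Build (Quotient.quot N) (Quotient.quot N')
    (quot_map sNN') (quot_map_zmod_morphism sNN').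

End QuotientMap.

Arguments quot_map {G} N N' sNN' x.

Section ProPCompletion.
Variables (p : nat) (G : zmodType).

Record pindex : Type := PIndex {
  pindex_sub :> zmodClosed G;
  pindexP : finite_pgroup p (Quotient.quot pindex_sub) }.

Definition pcompletion : Type :=
  invlim (fun (N N' : pindex) (h : {subset N <= N'}) =>
    quot_map N N' h : {additive Quotient.quot N -> Quotient.quot N'}).

HB.instance Definition _ := GRing.Zmodule.on pcompletion.
HB.instance Definition _ := Topological.on pcompletion.

Definition Psip_fun (g : G) : prodgroup (fun N : pindex => Quotient.quot N) :=
  fun N => (\pi_(Quotient.quot N) g)%qT.

Lemma Psip_coherent (g : G) :
  coherent (fun (N N' : pindex) (h : {subset N <= N'}) =>
    quot_map N N' h : {additive Quotient.quot N -> Quotient.quot N'}) (Psip_fun g).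
Proof. by apply/asboolP => N N' h; exact: quot_map_pi. Qed.

Definition Psip (g : G) : pcompletion := InvLim (Psip_coherent g).

End ProPCompletion.

Arguments hatp p {G} g.
Arguments Psip p {G} g.

(* Main.v *)
(** Write f_n : G -> Z/p^(n+1) for the coordinates of f in the dual. Since Z/q is injective over
    itself and G is torsion-free, every homomorphism G -> Z/p^(n+1) lifts to Z_p. So every N of
    finite p-power index is cut out by finitely many coordinates f_n, and each ker f_n is such an N;
    hence x in the completion determines eta x by (eta x)(f)_n = f_n(g) for any g representing
    x modulo ker f_n. Conversely, if f_n = 0 then f is divisible by p^(n+1), so phi(f)_n depends
    only on f_n for phi in the double dual; by duality for (Z/q)^T, phi agrees modulo p^(n+1) on any
    finite family with the evaluation at some g in G, and the class of g mod N is then determined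
    by phi. Both maps are continuous because each of their coordinates is locally constant. *)

From HB Require Import structures.
Require Import Defs.
From mathcomp Require Import all_boot all_fingroup all_algebra.
From mathcomp Require Import generic_quotient ring_quotient.
From mathcomp Require Import all_classical topology.

Set Implicit Arguments.
Unset Strict Implicit.
Unset Printing Implicit Defensive.

Import GRing.Theory.
Local Open Scope classical_set_scope.
Local Open Scope ring_scope.

(** Turns functions obtained by choice inside a proof into morphisms. *)
Lemma exists_additive (U V : zmodType) (f : U -> V) :
  zmod_morphism f -> exists F : {additive U -> V}, F =1 f.
Proof.
move=> fB; pose m := GRing.isZmodMorphism.Build _ _ f fB.
by exists (HB.pack_for {additive U -> V} f m).
Qed.

Lemma pair_mulrz (U V : zmodType) (u : U * V) j : u *~ j = (u.1 *~ j, u.2 *~ j).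
Proof. by rewrite [LHS]surjective_pairing (raddfMz fst) (raddfMz snd). Qed.

Lemma subrACA (V : zmodType) (x y z t : V) : x - y - (z - t) = x - z - (y - t).
Proof. by rewrite opprD addrACA -opprD. Qed.

Section PairArithmetic.
Variables (U V : zmodType) (a c : U) (b d : V).

Lemma pairD : (a, b) + (c, d) = (a + c, b + d). Proof. by []. Qed.

Lemma pairN : - (a, b) = (- a, - b). Proof. by []. Qed.

Lemma pairB : (a, b) - (c, d) = (a - c, b - d). Proof. by []. Qed.

End PairArithmetic.

(** * Subgroups as sets, and elements of order [p] modulo a subgroup *)

Section Subgroups.
Variable V : zmodType.

Definition subgroup (A : set V) : Prop :=
  A 0 /\ forall x y, A x -> A y -> A (x - y).

Variables (A : set V) (sA : subgroup A).

Lemma subgroup0 : A 0. Proof. by case: sA. Qed.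

Lemma subgroupB x y : A x -> A y -> A (x - y). Proof. by case: sA => _; apply. Qed.

Lemma subgroupN x : A x -> A (- x).
Proof. by rewrite -[- x]add0r; apply: subgroupB; exact: subgroup0. Qed.

Lemma subgroupD x y : A x -> A y -> A (x + y).
Proof. by move=> Ax Ay; rewrite -[y]opprK; apply/subgroupB/subgroupN. Qed.

Lemma subgroupMz x j : A x -> A (x *~ j).
Proof.
move=> Ax; have AMn k : A (x *+ k).
  by elim: k => [|k IH]; [rewrite mulr0n; exact: subgroup0 | rewrite mulrS; exact: subgroupD].
by case: j => k; [exact: (AMn k) | apply: subgroupN; exact: (AMn k.+1)].
Qed.

(** By Bézout, if [p] does not divide [j], then [x] is an integral combination of [x *+ p] and
    [x *~ j]. *)
Lemma subgroup_prime_dvd p x j : prime p -> A (x *+ p) -> ~ A x ->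
  A (x *~ j) -> (p%:Z %| j)%Z.
Proof.
move=> p_prime Apx nAx Ajx; apply: contrapT => /negP pj; apply: nAx.
have /coprimezP[[u v] /= uv] : coprimez p%:Z j.
  by rewrite /coprimez /gcdz /= eqz_nat -/(coprime _ _) prime_coprime.
rewrite -[x]mulr1z -uv mulrzDr.
by apply: subgroupD; rewrite mulrC mulrzA; apply: subgroupMz.
Qed.

(** The multiple found has order exactly [p] modulo [A], which is the situation of
    [subgroup_prime_dvd]. *)
Lemma subgroup_boundary p n x : A (x *+ p ^ n) -> ~ A x ->
  exists k, ~ A (x *+ p ^ k) /\ A (x *+ p ^ k *+ p).
Proof.
elim: n => [|n IH] Ax nAx; first by case: nAx.
have [|nAn] := pselect (A (x *+ p ^ n)); first by move=> /IH; exact.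
by exists n; rewrite -mulrnA -expnSr.
Qed.

End Subgroups.

(** * Injectivity of [Z/p^(n+1)] and separation by homomorphisms into it *)

Section CyclicTargets.
Variables (p : nat) (p_prime : prime p).

Lemma Zpow_gt1 n : (1 < p ^ n.+1)%N.
Proof. by rewrite -(expn0 p) ltn_exp2l ?prime_gt1. Qed.

Lemma Zpow_natr_eq0 n k : (k%:R == 0 :> 'Z_(p ^ n.+1)) = (p ^ n.+1 %| k)%N.
Proof. by rewrite -val_eqE /= val_Zp_nat ?Zpow_gt1. Qed.

Lemma Zpow_mulrn_eq0 n (c : 'Z_(p ^ n.+1)) : c *+ p ^ n.+1 = 0.
Proof. by rewrite -[c]natr_Zp -mulrnA; apply/eqP; rewrite Zpow_natr_eq0 dvdn_mull. Qed.

Lemma Zpow_divisible n (c : 'Z_(p ^ n.+1)) : c *+ p ^ n = 0 -> exists b, c = b *+ p.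
Proof.
rewrite -[c]natr_Zp; move: (nat_of_ord c) => k.
rewrite -mulrnA => /eqP; rewrite Zpow_natr_eq0 => pk.
have /dvdnP[b ->] : (p %| k)%N.
  by move: pk; rewrite expnS dvdn_pmul2r ?expn_gt0 ?prime_gt0.
by exists b%:R; rewrite mulrnA.
Qed.

Lemma padic_red1 n m (h : (m <= n)%N) : padic_red (p := p) h 1 = 1.
Proof. exact: val_inj. Qed.

Lemma padic_red_natr n m (h : (m <= n)%N) k : padic_red (p := p) h k%:R = k%:R.
Proof. by rewrite raddfMn /= padic_red1. Qed.

(** One step of Baer's argument, with partial homomorphisms encoded as graphs. Some multiple [y] of
    [x] lies outside the domain while [p y] lies in it; the value at [p y] is divisible by [p], and
    a quotient can be given to [y]. *)
Lemma extend_step n (Q : zmodType) (A : set (Q * 'Z_(p ^ n.+1))) x :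
  subgroup A -> (forall c, A (0, c) -> c = 0) ->
  (forall y, A (y *+ p ^ n.+1, 0)) -> ~ (exists c, A (x, c)) ->
  exists B, [/\ subgroup B, forall c, B (0, c) -> c = 0 & A `<` B].
Proof.
move=> sA fA A0 nAx; set D := [set y | exists c, A (y, c)].
have sD : subgroup D.
  split; first by exists 0; exact: subgroup0 sA.
  by move=> y z [c Ac] [d Ad]; exists (c - d); exact: (subgroupB sA Ac Ad).
have [|k [nDy [a Apy]]] := @subgroup_boundary _ D p n.+1 x _ nAx.
  by exists 0.
move: (x *+ p ^ k) nDy Apy => y nDy Aya {x nAx k}.
have AMz z c j : A (z, c) -> A (z *~ j, c *~ j).
  by move=> Azc; have := subgroupMz sA j Azc; rewrite pair_mulrz.
(* [A] contains both [(p^(n+1) y, p^n a)] and [(p^(n+1) y, 0)], so [p^n a = 0]. *)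
have [b ab] : exists b, a = b *+ p.
  apply: Zpow_divisible; apply: fA.
  have := subgroupB sA (AMz _ _ (p ^ n)%:Z Aya) (A0 y).
  by rewrite pairB -!pmulrn -mulrnA -expnS subrr subr0.
(* This is the subgroup generated by [A] and [(y, b)]. *)
exists [set u | exists j, A (u.1 - y *~ j, u.2 - b *~ j)]; split.
- split=> [|u v [i Au] [j Av]].
    by exists 0; rewrite /= !mulr0z !subr0; exact: subgroup0 sA.
  exists (i - j); rewrite !mulrzBr -[(u - v).1]/(u.1 - v.1) -[(u - v).2]/(u.2 - v.2).
  have := subgroupB sA Au Av; rewrite pairB.
  by rewrite subrACA [u.2 - _ - _]subrACA.
(* Here [j y] lies in [D], so [j = i p]; adding [i (p y, a)] to the element of [A] leaves
   [(0, c)]. *)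
- move=> c [j /= Aj].
  have /dvdzP[i ji] : (p%:Z %| j)%Z.
    apply: (subgroup_prime_dvd sD p_prime _ nDy); first by exists a.
    exists (- (c - b *~ j)).
    by have := subgroupN sA Aj; rewrite pairN sub0r opprK.
  have := subgroupD sA Aj (AMz _ _ i Aya).
  rewrite ji pairD ab !pmulrn -!mulrzA [i * _]mulrC !subrK.
  exact: fA.
- split=> [[z c] Az|BA]; first by exists 0; rewrite /= !mulr0z !subr0.
  apply: nDy; exists b; apply: BA; exists 1.
  by rewrite /= !mulr1z !subrr; exact: subgroup0 sA.
Qed.

(* Z/q is injective among the groups killed by q; the graph contains q Q, so
   the extension takes place in Q/qQ. *)
Lemma extend_graph n (Q : zmodType) (A0 : set (Q * 'Z_(p ^ n.+1))) :
  subgroup A0 -> (forall c, A0 (0, c) -> c = 0) ->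
  (forall y, A0 (y *+ p ^ n.+1, 0)) ->
  exists f : {additive Q -> 'Z_(p ^ n.+1)}, forall x c, A0 (x, c) -> f x = c.
Proof.
move=> sA0 fA0 qA0.
pose P A := A = set0 \/ [/\ subgroup A, forall c, A (0, c) -> c = 0 & A0 `<=` A].
have [F FP Ftot|A [PA maxA]] := @Zorn_bigcup _ P.
  have [[X [FX X0]]|F0] := pselect (exists X, F X /\ X !=set0); last first.
    left; rewrite -subset0 => u [X FX Xu]; apply: F0.
    by exists X; split=> //; exists u.
  have good Y u : F Y -> Y u -> [/\ subgroup Y, forall c, Y (0, c) -> c = 0 & A0 `<=` Y].
    by move=> /FP[-> //|].
  case: X0 => w Xw; have [sX fX A0X] := good _ _ FX Xw.
  right; split.
  - split; first by exists X => //; exact: subgroup0 sX.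
    move=> u v [Y FY Yu] [Z FZ Zv].
    have [sY _ _] := good _ _ FY Yu; have [sZ _ _] := good _ _ FZ Zv.
    have [YZ|ZY] := Ftot _ _ FY FZ.
      by exists Z => //; apply: subgroupB => //; exact: YZ.
    by exists Y => //; apply: subgroupB => //; exact: ZY.
  - by move=> c [Y FY Yc]; have [_ fY _] := good _ _ FY Yc; exact: fY.
  - by move=> u A0u; exists X => //; exact: A0X.
have {PA} [sA fA A0A] : [/\ subgroup A, forall c, A (0, c) -> c = 0 & A0 `<=` A].
  case: PA => // A_0; exfalso; apply: (maxA A0); last by right; split.
  by rewrite A_0; split=> // /(_ _ (subgroup0 sA0)).
have /choice[f Af] x : exists c, A (x, c).
  apply: contrapT => nAx.
  have [|B [sB fB AB]] := extend_step sA fA _ nAx; first by move=> y; exact: A0A.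
  by apply: (maxA B) => //; right; split=> //; exact: subset_trans (proj1 AB).
have fE x c : A (x, c) -> c = f x.
  move=> Axc; apply/eqP; rewrite -subr_eq0; apply/eqP; apply: fA.
  by have := subgroupB sA Axc (Af x); rewrite pairB subrr.
have [x y|F FE] := @exists_additive _ _ f.
  by apply/esym/fE; exact: (subgroupB sA (Af x) (Af y)).
by exists F => x c /A0A/fE ->; rewrite FE.
Qed.

(** A multiple [w = p^k v] has order [p] modulo [M], so sending [M] to 0 and [w] to [p^n], an
    element of order [p], is a partial homomorphism. Its extension satisfies [p^k f(v) = p^n], which
    is nonzero. *)
Lemma separate n (Q : zmodType) (M : set Q) v :
  subgroup M -> (forall y, M (y *+ p ^ n.+1)) -> ~ M v ->
  exists f : {additive Q -> 'Z_(p ^ n.+1)}, (forall x, M x -> f x = 0) /\ f v <> 0.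
Proof.
move=> sM qM nMv.
have [k [nMw Mpw]] := subgroup_boundary (qM v) nMv.
set w := v *+ p ^ k in nMw Mpw.
pose a : 'Z_(p ^ n.+1) := (p ^ n)%:R.
have pa : a *+ p = 0 by rewrite -mulrnA -expnSr; apply/eqP; rewrite Zpow_natr_eq0.
have [|c|y|f fE] := @extend_graph n Q [set u | exists j, M (u.1 - w *~ j) /\ u.2 = a *~ j].
- split; first by exists 0; rewrite !mulr0z subr0; split=> //; exact: subgroup0 sM.
  move=> x y [i [Mx xi]] [j [My yj]]; exists (i - j).
  rewrite -[(x - y).1]/(x.1 - y.1) -[(x - y).2]/(x.2 - y.2) xi yj !mulrzBr subrACA.
  by split=> //; exact: subgroupB.
- move=> [j [/=]]; rewrite sub0r => Mj ->.
  have /dvdzP[i ->] : (p%:Z %| j)%Z.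
    apply: (subgroup_prime_dvd sM p_prime Mpw nMw).
    by rewrite -[w *~ j]opprK; exact: subgroupN.
  by rewrite mulrC mulrzA -pmulrn pa mul0rz.
- by exists 0; rewrite /= !mulr0z subr0.
exists f; split=> [x Mx|fv0].
  by apply: fE; exists 0; rewrite /= !mulr0z subr0.
have : f w = a by apply: fE; exists 1; rewrite /= !mulr1z subrr; split=> //; exact: subgroup0 sM.
rewrite raddfMn /= fv0 mul0rn => /esym/eqP.
by rewrite Zpow_natr_eq0 dvdn_Pexp2l ?prime_gt1 // ltnn.
Qed.

End CyclicTargets.

(** * Coordinates and divisibility of p-adic integers *)

Section PadicCoordinates.
Variable p : nat.

Definition pcoord n (a : padic p) : 'Z_(p ^ n.+1) := invlim_val a n.

Lemma pcoord_zmod_morphism n : zmod_morphism (pcoord n).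
Proof. by []. Qed.
HB.instance Definition _ n :=
  GRing.isZmodMorphism.Build (padic p) 'Z_(p ^ n.+1) (pcoord n) (pcoord_zmod_morphism n).

Lemma padic_ext (a b : padic p) : (forall n, pcoord n a = pcoord n b) -> a = b.
Proof. by move=> ab; apply/val_inj/functional_extensionality_dep. Qed.

Lemma pcoord_red n m (h : (m <= n)%N) a : padic_red h (pcoord n a) = pcoord m a.
Proof. by case: a => x cx; exact: (asboolW cx). Qed.

Lemma padic_of_coords (x : forall n, 'Z_(p ^ n.+1)) :
  (forall n m (h : (m <= n)%N), padic_red h (x n) = x m) ->
  exists a, forall n, pcoord n a = x n.
Proof. by move=> /asboolT cx; exists (InvLim cx). Qed.

Hypothesis p_prime : prime p.

Lemma padic_red_comp n m l (h : (m <= n)%N) (h' : (l <= m)%N) (h'' : (l <= n)%N)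
    (c : 'Z_(p ^ n.+1)) : padic_red h' (padic_red h c) = padic_red h'' c.
Proof. by rewrite -[c]natr_Zp !padic_red_natr. Qed.

(** Turns coherence into arithmetic of natural representatives. *)
Lemma pcoord_natr n m a : (m <= n)%N -> pcoord m a = (pcoord n a : nat)%:R.
Proof. by move=> h; rewrite -(pcoord_red h) -[in LHS](natr_Zp (pcoord n a)) padic_red_natr. Qed.

Lemma Zpow_natr_eq n k l :
  (k%:R == l%:R :> 'Z_(p ^ n.+1)) = (k == l %[mod p ^ n.+1])%N.
Proof. by rewrite -val_eqE /= !val_Zp_nat ?Zpow_gt1. Qed.

(** Coordinate [m] of [a] is read from coordinate [m + n.+1], since cancelling [p^(n+1)] costs
    [n.+1] digits. *)
Lemma padic_mulrn_inj n a : a *+ p ^ n.+1 = 0 :> padic p -> a = 0.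
Proof.
move=> pa; apply: padic_ext => m; rewrite raddf0.
rewrite (pcoord_natr a (leq_addr n.+1 m)); apply/eqP; rewrite Zpow_natr_eq0 //.
have : pcoord (m + n.+1) (a *+ p ^ n.+1) == 0 by rewrite pa raddf0.
rewrite raddfMn /= -[X in X *+ _]natr_Zp -mulrnA Zpow_natr_eq0 //.
by move: (nat_of_ord _) => k; rewrite -addSn expnD dvdn_pmul2r ?expn_gt0 ?prime_gt0.
Qed.

Lemma padic_divisible n a : pcoord n a = 0 -> exists b, a = b *+ p ^ n.+1.
Proof.
move=> an0; set q := (p ^ n.+1)%N.
have q_gt0 : (0 < q)%N by rewrite expn_gt0 prime_gt0.
(* Coordinate [m] of the quotient will be [A m %/ q]: the [n.+1] extra digits are those lost in the
   division by [q]. *)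
pose A m := nat_of_ord (pcoord (m + n.+1) a).
have qA m : (A m %/ q * q)%N = A m.
  apply: divnK; rewrite /q -Zpow_natr_eq0 // -pcoord_natr ?an0 //.
  by rewrite addnS ltnW // ltnS leq_addl.
have [k m h|b bE] := @padic_of_coords (fun m => (A m %/ q)%:R).
  rewrite padic_red_natr //; apply/eqP; rewrite Zpow_natr_eq //.
  rewrite -(eqn_pmul2r q_gt0) !muln_modl !qA -expnD addSn -Zpow_natr_eq //.
  by rewrite natr_Zp -pcoord_natr ?leq_add2r.
exists b; apply: padic_ext => m.
by rewrite raddfMn /= bE -mulrnA qA -pcoord_natr ?leq_addr.
Qed.

End PadicCoordinates.

(** * Lifting to the dual, and finite approximation in the double dual *)

Section Lifting.
Variables (p : nat) (p_prime : prime p) (G : zmodType) (G_tf : torsion_free G).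

(** Multiplication by [p] embeds [Z/p^(n+1)] in [Z/p^(n+2)]. The partial map sending [p g] to
    [p f(g)] is well defined as [G] is torsion-free; an extension [F] has [p F(g) = p f(g)], so it
    reduces to [f]. *)
Lemma lift_step n (f : {additive G -> 'Z_(p ^ n.+1)}) :
  exists f' : {additive G -> 'Z_(p ^ n.+2)},
    forall g, padic_red (leqnSn n) (f' g) = f g.
Proof.
pose s (c : 'Z_(p ^ n.+1)) : 'Z_(p ^ n.+2) := (c : nat)%:R *+ p.
have s_natr k : s k%:R = k%:R *+ p.
  rewrite /s val_Zp_nat ?Zpow_gt1 // -!mulrnA; apply/eqP.
  by rewrite Zpow_natr_eq // (expnSr p n.+1) -!muln_modl modn_mod.
have sB c d : s (c - d) = s c - s d.
  apply: (addIr (s d)); rewrite subrK -[c]natr_Zp -[d]natr_Zp.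
  set e := _ - _; rewrite -[e]natr_Zp !s_natr -mulrnDl -natrD -!s_natr natrD.
  by rewrite natr_Zp subrK.
have [|c|y|F FE] := @extend_graph p p_prime n.+1 G
    [set u | exists g, u = (g *+ p, s (f g))].
- split; first by exists 0; rewrite mul0rn raddf0 /s mul0rn.
  by move=> _ _ [g ->] [g' ->]; exists (g - g'); rewrite pairB mulrnBl raddfB sB.
- by move=> [g [/esym/(G_tf (prime_gt0 p_prime)) -> ->]]; rewrite raddf0 /s mul0rn.
- exists (y *+ p ^ n.+1); rewrite -mulrnA -expnSr raddfMn /= Zpow_mulrn_eq0 //.
  by rewrite /s mul0rn.
exists F => g; have := FE (g *+ p) (s (f g)) (ex_intro _ g erefl).
rewrite raddfMn /= -[f g]natr_Zp -[F g]natr_Zp s_natr -!mulrnA padic_red_natr //.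
move: (nat_of_ord (F g)) (nat_of_ord (f g)) => a b.
move=> /eqP; rewrite Zpow_natr_eq // (expnSr p n.+1) -!muln_modl eqn_pmul2r ?prime_gt0 //.
by rewrite -Zpow_natr_eq // => /eqP.
Qed.

Lemma lift_pdual n (f : {additive G -> 'Z_(p ^ n.+1)}) :
  exists F : pdual p G, forall g, pcoord n (evalp g F) = f g.
Proof.
have step k h := cid (@lift_step k h).
pose F := fix F k : {additive G -> 'Z_(p ^ (k + n).+1)} :=
  if k is l.+1 then projT1 (step (l + n)%N (F l)) else f.
have FS k g : padic_red (leqnSn (k + n)) (F k.+1 g) = F k g.
  exact: (projT2 (step (k + n)%N (F k))).
have Fred m d (h : (m + n <= d + m + n)%N) g : padic_red h (F (d + m)%N g) = F m g.
  elim: d h => [|d IH] h; first by rewrite -[F _ g in LHS]natr_Zp padic_red_natr // natr_Zp.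
  have h' : (m + n <= d + m + n)%N by rewrite leq_add2r leq_addl.
  by rewrite -(IH h') -(FS (d + m)%N) (padic_red_comp _ _ h).
(* [F m] is known modulo [p^(m+n+1)], which suffices for coordinate [m]; for [m = n] the reduction
   goes back to [F 0 = f]. *)
pose x g m := padic_red (leq_addr n m) (F m g).
have [g|a aE] := @choice _ _ (fun g a => forall m, pcoord m a = x g m).
  apply: padic_of_coords => k m h; rewrite /x.
  have := Fred m (k - m)%N; rewrite subnK // => Fkm.
  have h' : (m + n <= k + n)%N by rewrite leq_add2r.
  rewrite -(Fkm h').
  by rewrite !(padic_red_comp _ _ (leq_trans h (leq_addr n k))).
have [g g'|A AE] := @exists_additive _ _ a.
  by apply: padic_ext => m; rewrite raddfB /= !aE /x !raddfB.
exists A => g; rewrite /evalp AE aE /x.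
by have := Fred 0%N n; rewrite addn0; exact.
Qed.

(** Pointwise [f = p^(n+1) F], where [F] is additive because [Z_p] has no [p]-torsion; then
    [phi f = p^(n+1) phi(F)]. *)
Lemma pddual_vanish n (f : pdual p G) (phi : pddual p G) :
  (forall g, pcoord n (evalp g f) = 0) ->
  pcoord n ((phi : {additive pdual p G -> padic p}) f) = 0.
Proof.
move=> f0; have /choice[a aE] g := padic_divisible p_prime (f0 g).
have [g g'|F FE] := @exists_additive _ _ a.
  apply/eqP; rewrite -subr_eq0; apply/eqP/(padic_mulrn_inj p_prime (n := n)).
  by rewrite 2!mulrnBl -!aE /evalp raddfB subrr.
have -> : f = (F : pdual p G) *+ p ^ n.+1.
  by apply: additive_ext => g; rewrite -[RHS]/(evalp g _) raddfMn /= /evalp FE -aE.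
by rewrite !raddfMn /= Zpow_mulrn_eq0.
Qed.

(** Otherwise some [chi] on [(Z/p^(n+1))^T] kills all evaluation vectors but not [v]. With
    coefficients [c] of [chi], the combination of the [f t] vanishes on [G] modulo [p^(n+1)], so by
    [pddual_vanish] its image under [phi] does too, that is [chi v = 0]. *)
Lemma pddual_approx n (T : finType) (f : T -> pdual p G) (phi : pddual p G) :
  exists g, forall t,
    pcoord n (evalp g (f t)) = pcoord n ((phi : {additive pdual p G -> padic p}) (f t)).
Proof.
set v := [ffun t => pcoord n ((phi : {additive pdual p G -> padic p}) (f t))]
  : {ffun T -> 'Z_(p ^ n.+1)}.
pose ev g := [ffun t => pcoord n (evalp g (f t))] : {ffun T -> 'Z_(p ^ n.+1)}.
have [[g _ gv]|nMv] := pselect ([set ev g | g in [set: G]] v).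
  by exists g => t; have /ffunP/(_ t) := gv; rewrite !ffunE.
exfalso.
have [||chi [chi0 []]] := @separate p p_prime n _ _ v _ _ nMv.
- split.
    by exists 0 => //; apply/ffunP => t; rewrite ffunE [RHS]ffunE /evalp !raddf0.
  move=> _ _ [g _ <-] [g' _ <-]; exists (g - g') => //.
  by apply/ffunP => t; rewrite !ffunE /evalp !raddfB.
- move=> y; exists 0 => //; apply/ffunP => t.
  by rewrite ffunMnE Zpow_mulrn_eq0 // ffunE /evalp !raddf0.
(* Natural coefficients, so that the same combination makes sense in the dual. *)
pose c t := nat_of_ord (chi [ffun s => (s == t)%:R]).
have chiE u : chi u = \sum_t u t *+ c t.
  have {1}-> : u = \sum_t [ffun s => (s == t)%:R] *+ (u t : nat).
    apply/ffunP => s; rewrite sum_ffunE (bigD1 s) //= big1 => [|t ts].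
      by rewrite addr0 ffunMnE ffunE eqxx natr_Zp.
    by rewrite ffunMnE ffunE eq_sym (negbTE ts) mul0rn.
  rewrite raddf_sum; apply: eq_bigr => t _.
  by rewrite raddfMn /= -[chi _]natr_Zp -[in RHS](natr_Zp (u t)) -!mulrnA mulnC.
have hE (h : {additive pdual p G -> padic p}) :
    pcoord n (h (\sum_t f t *+ c t)) = \sum_t pcoord n (h (f t)) *+ c t.
  by rewrite !raddf_sum; apply: eq_bigr => t _; rewrite !raddfMn.
rewrite chiE; under eq_bigr do rewrite ffunE.
rewrite -hE; apply: pddual_vanish => g.
rewrite hE -[RHS](chi0 (ev g)); last by exists g.
by rewrite chiE; apply: eq_bigr => t _; rewrite ffunE.
Qed.

End Lifting.

(** * Kernels, quotients and subgroups of finite p-power index *)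

Section Kernels.
Variables (G V : zmodType) (u : {additive G -> V}).

Definition kernel : {pred G} := fun g => u g == 0.

Lemma kernel_zmod_closed : zmod_closed kernel.
Proof.
split=> [|x y /eqP ux /eqP uy]; rewrite -topredE /= /kernel ?raddf0 //.
by rewrite raddfB ux uy subrr.
Qed.
HB.instance Definition _ := GRing.isZmodClosed.Build G kernel kernel_zmod_closed.

End Kernels.

Lemma quot_eqP (G : zmodType) (N : zmodClosed G) (g h : G) :
  (\pi_(Quotient.quot N) g = \pi_(Quotient.quot N) h)%qT <-> g - h \in N.
Proof. by rewrite Quotient.idealrBE; split=> [->|/eqP]. Qed.

Lemma quot_eq0P (G : zmodType) (N : zmodClosed G) (g : G) :
  (\pi_(Quotient.quot N) g)%qT = 0 <-> g \in N.
Proof. by rewrite -[g in g \in N]subr0 -quot_eqP raddf0. Qed.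

Section FinitePGroups.
Variables (p : nat) (p_prime : prime p).

(** By Lagrange the image of [u] has order dividing [p^k], hence a power of [p]. *)
Lemma finite_pgroup_embedding (Q : zmodType) (V : finZmodType)
    (u : {additive Q -> V}) k :
  injective u -> #|V| = (p ^ k)%N -> finite_pgroup p Q.
Proof.
move=> u_inj V_p; pose I := [set v : V | `[< exists x, u x = v >]]%SET.
have inI v : reflect (exists x, u x = v) (v \in I) by rewrite inE; exact: asboolP.
have gI : group_set I.
  apply/group_setP; split=> [|v w /inI[x <-] /inI[y <-]].
    by apply/inI; exists 0; rewrite raddf0.
  by rewrite FinRing.zmodMgE; apply/inI; exists (x + y); rewrite raddfD.
have : (#|I| %| p ^ k)%N.
  by have := @cardSg V [set: V]%G (Group gI) (finset.subsetT _); rewrite cardsT V_p.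
move=> /(dvdn_pfactor _ _ p_prime)[j _ I_p]; exists j.
have memI x : u x \in enum I by rewrite mem_enum; apply/inI; exists x.
apply/card_set_bijP; exists (fun x => index (u x) (enum I)); split.
- by move=> x _ /=; rewrite -I_p cardE index_mem.
- by move=> x y _ _ /(congr1 (nth 0 (enum I))); rewrite !nth_index // => /u_inj.
- move=> i /=; rewrite -I_p cardE => lti.
  have /inI[x xE] : nth 0 (enum I) i \in I by rewrite -mem_enum mem_nth.
  by exists x => //; rewrite xE index_uniq ?enum_uniq.
Qed.

Lemma finite_pgroup_enum (Q : zmodType) : finite_pgroup p Q ->
  exists k (e : 'I_(p ^ k) -> Q), bijective e.
Proof.
move=> [k /card_set_bijP[r [r_lt r_inj r_surj]]]; exists k.
have ltr x : (r x < p ^ k)%N by exact: r_lt.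
have /choice[e eE] (i : 'I_(p ^ k)) : exists x, r x = i.
  by have [x _ xE] := r_surj i (ltn_ord i); exists x.
exists e; exists (fun x => Ordinal (ltr x)) => [i|x]; first by apply: val_inj; exact: eE.
by apply: r_inj => //; rewrite ?inE // eE.
Qed.

(** Translation by [x] permutes [Q], so it preserves the sum of all elements, while adding [x *+ m]
    to it. *)
Lemma mulrn_card_eq0 (Q : zmodType) m (e : 'I_m -> Q) (x : Q) : bijective e -> x *+ m = 0.
Proof.
move=> [r re er].
have sE : \sum_i e i = \sum_i e (r (e i + x)).
  apply: (reindex (fun i => r (e i + x))); exists (fun i => r (e i - x)) => i _ /=.
    by rewrite er addrK re.
  by rewrite er subrK re.
apply: (addrI (\sum_i e i)); rewrite addr0 {2}sE.
under [RHS]eq_bigr do rewrite er.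
by rewrite big_split /= sumr_const card_ord.
Qed.

Variable G : zmodType.

Lemma kernel_pindex (V : finZmodType) (u : {additive G -> V}) k : #|V| = (p ^ k)%N ->
  exists N : pindex p G, forall g, (g \in pindex_sub N) = (u g == 0).
Proof.
move=> V_p; pose N : zmodClosed G := kernel u.
have piE g : u (repr (\pi_(Quotient.quot N) g)%qT) = u g.
  apply/eqP; rewrite -subr_eq0 -raddfB.
  have : repr (\pi_(Quotient.quot N) g)%qT - g \in N by apply/quot_eqP; rewrite reprK.
  by [].
have [x y|v vE] := @exists_additive (Quotient.quot N) V (u \o repr).
  by rewrite /= -[x in LHS]reprK -[y in LHS]reprK -raddfB piE raddfB.
have v_inj : injective v.
  move=> x y; rewrite !vE /= => uxy; rewrite -[x]reprK -[y]reprK.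
  by apply/quot_eqP; rewrite -[_ \in _]/(u _ == 0) raddfB uxy subrr.
by exists (PIndex (finite_pgroup_embedding v_inj V_p)).
Qed.

Lemma card_Zpow n : #|'Z_(p ^ n.+1)| = (p ^ n.+1)%N.
Proof. by rewrite card_ord Zp_cast ?Zpow_gt1. Qed.

Hypothesis G_tf : torsion_free G.

(** Each nonzero class of [G/N] is detected by a homomorphism from [separate], whose composite with
    the projection lifts to the dual; the family has one member per class. *)
Lemma pindex_family (N : pindex p G) :
  exists n (T : finType) (f : T -> pdual p G),
    forall g, g \in pindex_sub N <-> forall t, pcoord n (evalp g (f t)) = 0.
Proof.
have [k [e e_bij]] := finite_pgroup_enum (pindexP N).
(* Coordinate [k] takes values in [Z/p^(k+1)], one power of [p] above the order of [G/N], as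
   exponents start at 1. *)
exists k, 'I_(p ^ k).
pose pi g : Quotient.quot N := (\pi_(Quotient.quot N) g)%qT.
suff /choice[f fE] : forall t, exists f : pdual p G,
    (forall g, g \in pindex_sub N -> pcoord k (evalp g f) = 0) /\
    (forall g, pi g = e t -> pcoord k (evalp g f) = 0 -> pi g = 0).
  exists f => g; split=> [gN t|f0]; first exact: (proj1 (fE t)).
  have [r _ er] := e_bij; have [_ /(_ g)] := fE (r (pi g)).
  by rewrite er => /(_ erefl (f0 _)) /quot_eq0P.
move=> t; have [et0|et0] := pselect (e t = 0).
  by exists 0; split=> [g _|g ->]; rewrite ?raddf0.
have [||chi [_ chi_et]] := @separate p p_prime k _ [set 0] (e t) _ _ et0.
- by split=> // x y /= -> ->; rewrite subrr.
- by move=> y /=; rewrite expnSr mulrnA (mulrn_card_eq0 _ e_bij) mul0rn.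
have [g h|u uE] := @exists_additive G _ (chi \o pi).
  by rewrite /= /pi !raddfB.
have [f fE] := lift_pdual p_prime G_tf u.
exists f; split=> g; rewrite fE uE /=.
  by move=> /quot_eq0P; rewrite -/(pi g) => ->; rewrite raddf0.
by move=> ->.
Qed.

End FinitePGroups.

(** * Continuity as local constancy of coordinates *)

Section Topology.

Lemma prod_proj_continuous (I : Type) (K : I -> topologicalType) i :
  continuous (fun x : prod_topology K => x i).
Proof.
move=> x; have /cvg_sup/(_ i) xi : x --> x by exact: cvg_id.
move=> A /(@initial_continuous _ _ (fun z : prod_topology K => z i) x A).
exact: xi.
Qed.

Lemma prod_continuous (T : topologicalType) (I : Type) (K : I -> topologicalType)
    (F : T -> prod_topology K) :
  (forall i, continuous (fun t => F t i)) -> continuous F.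
Proof.
move=> Fi t; apply/cvg_sup => i.
exact: (@continuous_comp_initial _ _ _ (fun z : prod_topology K => z i) F (Fi i) t).
Qed.

Lemma discrete_continuousP (T : topologicalType) (D : choiceType)
    (F : T -> discrete_topology D) :
  continuous F <-> forall t, \forall s \near t, F s = F t.
Proof.
split=> [cF t|cF t A]; first apply: (cF t [set d | d = F t]).
  by rewrite nbhs_principalE; apply/principal_filterP.
rewrite nbhs_principalE => /principal_filterP At.
by apply: filterS (cF t) => s /= ->.
Qed.

Variables (I : Type) (r : I -> I -> Prop) (X : I -> zmodType).
Variable f : forall i j, r i j -> {additive X i -> X j}.

Lemma invlim_near (x : invlim f) i : \forall y \near x, invlim_val y i = invlim_val x i.
Proof.
have ci : continuous (fun y : invlim f => invlim_incl y i).
  have pi := @prod_proj_continuous _ (fun i => discrete_topology (X i)) i.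
  move=> y; exact: cvg_comp (@initial_continuous _ _ (@invlim_incl _ _ _ f) y) (pi _).
exact: (proj1 (discrete_continuousP _) ci).
Qed.

Lemma continuous_invlim (T : topologicalType) (F : T -> invlim f) :
  (forall t i, \forall s \near t, invlim_val (F s) i = invlim_val (F t) i) -> continuous F.
Proof.
move=> Fi; apply: (@continuous_comp_initial _ _ _ (@invlim_incl _ _ _ f)).
apply: prod_continuous => i; apply/discrete_continuousP => t; exact: Fi.
Qed.

End Topology.

Section DualTopology.
Variables (p : nat) (G : zmodType).

Definition peval (phi : pddual p G) (f : pdual p G) : padic p :=
  (phi : {additive pdual p G -> padic p}) f.

Lemma pddual_near (phi : pddual p G) f n :
  \forall psi \near phi, pcoord n (peval psi f) = pcoord n (peval phi f).
Proof.
have cf : continuous (fun psi : pddual p G => peval psi f).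
  have pf := @prod_proj_continuous (pdual p G) (fun=> padic p) f.
  move=> psi; exact: cvg_comp (@initial_continuous _ _ (@pddual_incl p G) psi) (pf _).
exact: cf (invlim_near (peval phi f) n).
Qed.

Lemma continuous_pddual (T : topologicalType) (F : T -> pddual p G) :
  (forall t f n, \forall s \near t, pcoord n (peval (F s) f) = pcoord n (peval (F t) f)) ->
  continuous F.
Proof.
move=> Ff; apply: (@continuous_comp_initial _ _ _ (@pddual_incl p G)).
apply: (@prod_continuous _ _ (fun=> padic p)) => f.
apply: (@continuous_invlim _ _ _ _ _ (fun t => peval (F t) f)) => t n.
exact: Ff.
Qed.

End DualTopology.

(** * Comparison of the completion with the double dual *)

Section DoubleDual.
Variables (p : nat) (p_prime : prime p) (G : zmodType) (G_tf : torsion_free G).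

Lemma evalpBl (g h : G) (f : pdual p G) : evalp (g - h) f = evalp g f - evalp h f.
Proof. exact: raddfB. Qed.

Lemma evalpBr (g : G) (f f' : pdual p G) : evalp g (f - f') = evalp g f - evalp g f'.
Proof. exact: raddfB. Qed.

(** In other words, the coordinate [f_n] factors through [G/N]. *)
Definition kills (N : pindex p G) (f : pdual p G) n : Prop :=
  forall g, g \in pindex_sub N -> pcoord n (evalp g f) = 0.

Lemma kills_eq N f n g h : kills N f n -> g - h \in pindex_sub N ->
  pcoord n (evalp g f) = pcoord n (evalp h f).
Proof.
by move=> Nf /Nf; rewrite evalpBl raddfB => /eqP; rewrite subr_eq0 => /eqP.
Qed.

Lemma pindex_family_sub n (T : finType) (f : T -> pdual p G) (N : pindex p G) :
  (forall g, g \in pindex_sub N <-> forall t, pcoord n (evalp g (f t)) = 0) ->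
  forall g h, (forall t, pcoord n (evalp g (f t)) = pcoord n (evalp h (f t))) ->
  g - h \in pindex_sub N.
Proof. by move=> fE g h gh; apply/fE => t; rewrite evalpBl raddfB /= gh subrr. Qed.

Lemma kills_sub (N : pindex p G) g h :
  (forall f n, kills N f n -> pcoord n (evalp g f) = pcoord n (evalp h f)) ->
  g - h \in pindex_sub N.
Proof.
move=> gh; have [n [T [F FE]]] := pindex_family p_prime G_tf N.
by apply: (pindex_family_sub FE) => t; apply: gh => x /FE.
Qed.

(* [phi] is first approximated on a family cutting out [N]; enlarging the
   family by any other [f] only changes the approximation within [N]. *)
Lemma pddual_rep (phi : pddual p G) (N : pindex p G) : exists g, forall f n,
  kills N f n -> pcoord n (evalp g f) = pcoord n (peval phi f).
Proof.
have [n [T [F FE]]] := pindex_family p_prime G_tf N.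
have [g gF] := pddual_approx p_prime n F phi.
exists g => f m Nf.
(* [None] stands for the added [f]; precision [maxn n m] serves both the family and [f]. *)
have [h hF] := pddual_approx p_prime (maxn n m) (fun t => if t is Some t then F t else f) phi.
have hf k t : (k <= maxn n m)%N -> pcoord k (evalp h (if t is Some t then F t else f)) =
    pcoord k (peval phi (if t is Some t then F t else f)).
  by move=> le_k; rewrite -!(pcoord_red le_k) hF.
rewrite -(hf m None) ?leq_maxr //; apply: (kills_eq Nf).
apply: (pindex_family_sub FE) => t.
by rewrite gF -(hf n (Some t)) ?leq_maxl.
Qed.

Lemma pcompletion_ext (x y : pcompletion p G) :
  (forall N, invlim_val x N = invlim_val y N) -> x = y.
Proof. by move=> xy; apply/val_inj/functional_extensionality_dep. Qed.

Lemma pcompletion_pi (x : pcompletion p G) (N N' : pindex p G) g :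
  {subset pindex_sub N <= pindex_sub N'} ->
  invlim_val x N = (\pi_(Quotient.quot N) g)%qT ->
  invlim_val x N' = (\pi_(Quotient.quot N') g)%qT.
Proof.
case: x => x /= /asboolP cx sNN' xN.
by rewrite -(cx _ _ sNN') xN; exact: quot_map_pi.
Qed.

(** The kernel of [(f_n, f'_n)] into [(Z/p^(n+1))^2]. Taking two functionals at once lets additivity
    be checked at a single [N]. *)
Lemma pindex_kernel (f f' : pdual p G) n : exists N : pindex p G,
  forall g, (g \in pindex_sub N) =
    (pcoord n (evalp g f) == 0) && (pcoord n (evalp g f') == 0).
Proof.
pose c (i : 'I_2) := if i == ord0 then f else f'.
have [g h|u uE] := @exists_additive G 'rV['Z_(p ^ n.+1)]_2
    (fun g => \row_i pcoord n (evalp g (c i))).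
  by apply/rowP => i; rewrite !mxE evalpBl raddfB.
have [|N NE] := kernel_pindex (k := (n.+1 * (1 * 2))%N) p_prime u.
  by rewrite card_mx card_Zpow // -expnM.
exists N => g; rewrite NE uE; apply/eqP/andP => [/rowP cg|[/eqP fg /eqP f'g]].
  by have := cg ord0; have := cg ord_max; rewrite !mxE /c /= => -> ->.
by apply/rowP => i; rewrite !mxE /c; case: ifP.
Qed.

(* [evaluates x a f] expresses that [a] is the value at [f] of the image of
   [x] in the double dual. *)
Definition evaluates (x : pcompletion p G) (f : pdual p G) (a : padic p) : Prop :=
  forall (N : pindex p G) g n, kills N f n ->
    invlim_val x N = (\pi_(Quotient.quot N) g)%qT -> pcoord n a = pcoord n (evalp g f).

Lemma evaluates_unique x f a b : evaluates x f a -> evaluates x f b -> a = b.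
Proof.
move=> xa xb; apply: padic_ext => n; have [N NE] := pindex_kernel f f n.
have Nf : kills N f n by move=> g; rewrite NE => /andP[/eqP].
have xN := esym (reprK (invlim_val x N)).
by rewrite (xa N _ n Nf xN) (xb N _ n Nf xN).
Qed.

(** Coordinate [n] is read modulo [K n], the kernel of [f_n]. Any [N] killed by [f_n] lies in [K n],
    so coherence of [x] gives the same value there. *)
Lemma evaluates_exists x f : exists a, evaluates x f a.
Proof.
have /choice[K KE] n := pindex_kernel f f n.
have Kin n g : g \in pindex_sub (K n) <-> pcoord n (evalp g f) = 0.
  by rewrite KE andbb; split=> /eqP.
have Kf n : kills (K n) f n by move=> g /Kin.
pose c n := pcoord n (evalp (repr (invlim_val x (K n))) f).
have cE (N : pindex p G) g n : kills N f n ->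
    invlim_val x N = (\pi_(Quotient.quot N) g)%qT -> c n = pcoord n (evalp g f).
  move=> Nf xN; apply: (kills_eq (Kf n)); apply/quot_eqP; rewrite reprK.
  by apply: pcompletion_pi xN => h /Nf /Kin.
have [n m le_mn|a aE] := @padic_of_coords p c.
  rewrite pcoord_red; apply/esym/(cE (K n)); last by rewrite reprK.
  by move=> g /Kin fg0; rewrite -(pcoord_red le_mn) fg0 raddf0.
by exists a => N g n Nf xN; rewrite aE; exact: cE xN.
Qed.

(** All three values come from one representative modulo the common kernel of [f_n] and [f'_n]. *)
Lemma evaluatesBr x f f' a a' :
  evaluates x f a -> evaluates x f' a' -> evaluates x (f - f') (a - a').
Proof.
move=> xa xa'; have [b xb] := evaluates_exists x (f - f').
suff -> : a - a' = b by [].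
apply: padic_ext => n; have [N NE] := pindex_kernel f f' n.
have Nf : kills N f n by move=> g; rewrite NE => /andP[/eqP].
have Nf' : kills N f' n by move=> g; rewrite NE => /andP[_ /eqP].
have Nff' : kills N (f - f') n.
  by move=> g gN; rewrite evalpBr raddfB /= Nf // Nf' // subrr.
have xN := esym (reprK (invlim_val x N)).
rewrite raddfB /= (xa N _ n Nf xN) (xa' N _ n Nf' xN) (xb N _ n Nff' xN).
by rewrite -raddfB -evalpBr.
Qed.

Lemma evaluatesBl x y f a b :
  evaluates x f a -> evaluates y f b -> evaluates (x - y) f (a - b).
Proof.
move=> xa yb; have [c xyc] := evaluates_exists (x - y) f.
suff -> : a - b = c by [].
apply: padic_ext => n; have [N NE] := pindex_kernel f f n.
have Nf : kills N f n by move=> g; rewrite NE => /andP[/eqP].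
have xN := esym (reprK (invlim_val x N)).
have yN := esym (reprK (invlim_val y N)).
rewrite raddfB /= (xa N _ n Nf xN) (yb N _ n Nf yN) -raddfB -evalpBl.
apply/esym/(xyc N) => //.
by rewrite [RHS]raddfB /= !reprK.
Qed.

(** Uniqueness of values makes each [eta x] additive through [evaluatesBr], and [eta] itself through
    [evaluatesBl]. *)
Lemma double_dual_map : exists eta : {additive pcompletion p G -> pddual p G},
  forall x f, evaluates x f (peval (eta x) f).
Proof.
have phiP x : exists phi : pddual p G, forall f, evaluates x f (peval phi f).
  have /choice[a xa] f := evaluates_exists x f.
  have [f f'|phi phiE] := @exists_additive (pdual p G) (padic p) a.
    exact: evaluates_unique (xa _) (evaluatesBr (xa f) (xa f')).
  by exists phi => f; rewrite /peval phiE.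
have /choice[eta etaE] := phiP.
have [x y|eta' eta'E] := @exists_additive _ _ eta.
  apply: additive_ext => f.
  exact: evaluates_unique (etaE _ f) (evaluatesBl (etaE x f) (etaE y f)).
by exists eta' => x f; rewrite eta'E.
Qed.

Lemma evaluates_inj x y (a : pdual p G -> padic p) :
  (forall f, evaluates x f (a f)) -> (forall f, evaluates y f (a f)) -> x = y.
Proof.
move=> xa ya; apply: pcompletion_ext => N.
have xN := esym (reprK (invlim_val x N)); have yN := esym (reprK (invlim_val y N)).
rewrite xN yN; apply/quot_eqP/kills_sub => f n Nf.
by rewrite -(xa f N _ n Nf xN) -(ya f N _ n Nf yN).
Qed.

(** The representatives chosen for [N] and a larger [N'] both agree with [phi] on coordinates
    killing [N'], and these separate [G/N']. *)
Lemma evaluates_surj (phi : pddual p G) : exists x, forall f, evaluates x f (peval phi f).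
Proof.
have /choice[g gE] N := pddual_rep phi N.
have cg : coherent (fun (N N' : pindex p G)
      (h : {subset pindex_sub N <= pindex_sub N'}) => quot_map N N' h :
      {additive Quotient.quot N -> Quotient.quot N'})
    (fun N => (\pi_(Quotient.quot N) (g N))%qT).
  apply/asboolP => N N' sNN'; rewrite /= quot_map_pi.
  apply/quot_eqP/kills_sub => f n N'f.
  by rewrite !gE // => h /sNN' /N'f.
exists (InvLim cg) => f N h n Nf /= /quot_eqP ghN.
by rewrite -(gE N f n Nf); exact: kills_eq ghN.
Qed.

Lemma evaluates_Psip g f : evaluates (Psip p g) f (evalp g f).
Proof. by move=> N h n Nf /quot_eqP; exact: kills_eq. Qed.

(** Coordinate [n] of the value at [f] depends only on [x] modulo the kernel of [f_n]. *)
Lemma evaluates_continuous (eta : pcompletion p G -> pddual p G) :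
  (forall x f, evaluates x f (peval (eta x) f)) -> continuous eta.
Proof.
move=> etaE; apply: continuous_pddual => x f n; have [N NE] := pindex_kernel f f n.
have Nf : kills N f n by move=> g; rewrite NE => /andP[/eqP].
have xN := esym (reprK (invlim_val x N)).
apply: filterS (invlim_near x N) => y yN.
by rewrite (etaE x f N _ n Nf xN) (etaE y f N _ n Nf (etrans yN xN)).
Qed.

Lemma evaluates_inverse_continuous (psi : pddual p G -> pcompletion p G) :
  (forall phi f, evaluates (psi phi) f (peval phi f)) -> continuous psi.
Proof.
move=> psiE; apply: continuous_invlim => phi N.
have [n [T [F FE]]] := pindex_family p_prime G_tf N.
have NF t : kills N (F t) n by move=> g /FE.
(* Finiteness of [T] yields one neighbourhood on which all the coordinates that determine the class
   modulo [N] are constant. *)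
have := filter_forall (nbhs_filter phi) (fun t => pddual_near phi (F t) n).
apply: filterS => phi' phi'F.
have phiN := esym (reprK (invlim_val (psi phi) N)).
have phi'N := esym (reprK (invlim_val (psi phi') N)).
rewrite phiN phi'N; apply/quot_eqP/(pindex_family_sub FE) => t.
by rewrite -(psiE phi (F t) N _ n (NF t) phiN) -(psiE phi' (F t) N _ n (NF t) phi'N).
Qed.

End DoubleDual.

Theorem theorem4p3 (p : nat) (p_prime : prime p) (G : zmodType)
    (G_tf : torsion_free G) :
  exists eta : {additive pcompletion p G -> pddual p G},
    [/\ bijective eta,
        forall g : G, eta (Psip p g) = hatp p g
      & homeomorphism eta].
Proof.
have [eta etaE] := double_dual_map p_prime G.
have /choice[psi psiE] := evaluates_surj p_prime G_tf.
have etaK : cancel eta psi.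
  by move=> x; apply: (evaluates_inj p_prime G_tf (psiE (eta x))); exact: etaE.
have psiK : cancel psi eta.
  move=> phi; apply: additive_ext => f.
  exact: (evaluates_unique p_prime (etaE (psi phi) f) (psiE phi f)).
exists eta; split; first by exists psi.
- move=> g; apply: additive_ext => f.
  exact: (evaluates_unique p_prime (etaE (Psip p g) f) (@evaluates_Psip p G g f)).
- split; first exact: evaluates_continuous etaE.
  by exists psi; split=> //; exact: evaluates_inverse_continuous psiE.
Qed.
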